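(* For $n\in1+2\mathbb{Z}_{\ge0}$ put $\gamma_n=\prod_{\ell=0}^{\frac{n-1}{2}}(n-4\ell)$. Then $$P_{\frac{n+1}{2}}(x;n)=\gamma_n\prod_{\ell=0}^{\frac{n-1}{2}}\big(x-(n-1)+4\ell\big).$$ Equivalently, $$P_{\frac{n+1}{2}}(x;n)=\begin{cases}\gamma_n\,x\prod_{\ell=1}^{\frac{n-1}{4}}\big(x^2-(4\ell)^2\big) & \text{if } n\equiv1\pmod4,\\ \gamma_n\prod_{\ell=0}^{\frac{n-3}{4}}\big(x^2-(4\ell+2)^2\big) & \text{if } n\equiv3\pmod4.\end{cases}$$
   Context: Put $a(x)=2x(2x-1)$. $P_0(x;y)=1$, and for $k\ge1$, $P_k(x;y)$ is the determinant of the $k\times k$ tridiagonal matrix with diagonal entries $(y-4(i-1))x$ in position $(i,i)$ $(1\le i\le k)$, entries $a(i)$ in position $(i,i+1)$, and entries $-a\left(\frac{y-2i+2}{2}\right)$ in position $(i+1,i)$ $(1\le i\le k-1)$. Empty products $\prod_{\ell=j}^{j-1}$ are equal to $1$. *)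

(* Defs.v *)
From mathcomp Require Import all_boot all_order all_algebra.

Set Implicit Arguments.
Unset Strict Implicit.
Unset Printing Implicit Defensive.

Import GRing.Theory.
Local Open Scope ring_scope.

Definition a (F : fieldType) (t : F) : F := 2 * t * (2 * t - 1).

(* Ordinals start at 0, so the 1-based row and column indices of the usual
   description are i.+1 and j.+1; the entry below the diagonal in the 1-based
   position (j.+2, j.+1) involves the column index j.+1. *)
Definition Pmx (F : fieldType) (k : nat) (y : F) : 'M[{poly F}]_k :=
  \matrix_(i < k, j < k)
    if j == i :> nat then (y - 4 * i%:R)%:P * 'X
    else if j == i.+1 :> nat then (a (i.+1%:R : F))%:P
    else if i == j.+1 :> nat then (- a ((y - 2 * j.+1%:R + 2) / 2))%:P
    else 0.

(* P_k(x; y) as a polynomial in the indeterminate x, with parameter y : F. *)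
Definition P (F : fieldType) (k : nat) (y : F) : {poly F} := \det (Pmx k y).

Lemma P0 (F : fieldType) (y : F) : P 0 y = 1.
Proof. exact: det_mx00. Qed.

Definition gamma (n : nat) : int :=
  \prod_(0 <= l < (n.-1 %/ 2).+1) (n%:Z - 4 * l%:Z).

(* Main.v *)
Require Import Defs.
From mathcomp Require Import all_boot all_order all_algebra.
From mathcomp Require Import ring zify.

Set Implicit Arguments.
Unset Strict Implicit.
Unset Printing Implicit Defensive.

Import GRing.Theory.
Local Open Scope ring_scope.

(** The matrix is the matrix of an operator on polynomials, and a change of
    basis makes that operator bidiagonal.

    Let n = 2m+1 and let sl2 act on polynomials of degree at most n in t (binary
    forms of degree n in s and t, with s = 1) by E = d/dt, F = t (n - theta)
    and H = n - 2 theta, where theta = t d/dt.  On t^(2i), E^2 is multiplication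
    by 2i(2i-1), F^2 by (n-2i)(n-2i-1) and H by n - 4i, up to the shifts of i.
    Hence column vectors v with v_i = [t^(2i)] f turn the matrix of P_(m+1)(x; n)
    into the operator T_x = E^2 - F^2 + x H ([coef_pencil_even]).

    Since EF - FE = H, one has T_x = (E-F)(E+F) + (x-1) H.  The eigenvectors of
    E+F are (1+t)^p (1-t)^q with p + q = n and eigenvalue p - q, while E-F and H
    send such a vector to the two neighbouring ones.  So T_x sends the vector
    of index q to a combination of those of index q+1 and q-1 only, with
    coefficients p (x-1+p-q) and q (x-1-p+q) ([pencil_weight]).  A combination of
    the vectors of even index q = 2l, 0 <= l <= m, is therefore killed by T_x as
    soon as its coefficients satisfy a first-order recursion and one last
    coefficient, proportional to the product of the x-1+n-4l, vanishes
    ([pencil_kernel_poly]).  That happens for the m+1 values x = 4L - (n-1),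
    0 <= L <= m.  The values of the resulting f at 1 and -1 are 2^n and 0, so f
    is not odd: its even coefficients form a nonzero kernel vector
    ([kernel_poly_even_neq0]).

    Dividing row i by n - 4i, which is nonzero as n is odd, identifies P with
    gamma_n times a characteristic polynomial ([P_char_poly]).  This one is
    monic of degree m+1 and has the m+1 distinct roots 4L - (n-1), which gives
    the first product ([P_factor]).  The two other forms pair the opposite
    roots. *)

(** * The sl2 action and its weight vectors *)

Section Sl2.
Variables (F : fieldType).
Implicit Types (f : {poly F}) (x : F).

(** The operator t (n - theta), i.e. t d/ds on binary forms of degree n. *)
Definition lower (n : nat) f : {poly F} := 'X * (n%:R * f) - 'X^2 * f^`().
(** The operator n - 2 theta, i.e. s d/ds - t d/dt on binary forms. *)
Definition cartan (n : nat) f : {poly F} := n%:R * f - 2 * 'X * f^`().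
Definition pencil (n : nat) x f : {poly F} :=
  f^`()^`() - lower n (lower n f) + x%:P * cartan n f.
(** The weight vectors of the raising plus the lowering operator. *)
Definition weight (p q : nat) : {poly F} := (1 + 'X) ^+ p * (1 - 'X) ^+ q.

Lemma deriv_weight p q :
  (weight p q)^`() = p%:R * weight p.-1 q - q%:R * weight p q.-1.
Proof.
by rewrite /weight derivM !deriv_exp derivD derivB derivX !derivE; ring.
Qed.

(** In the coordinates u = s + t and w = s - t, the three operators on the left
    are u d/du - w d/dw, w d/du - u d/dw and w d/du + u d/dw, applied to
    u^p w^q. *)
Lemma sl2_weight p q :
  [/\ (weight p q)^`() + lower (p + q) (weight p q)
        = (p%:R - q%:R) * weight p q,
      (weight p q)^`() - lower (p + q) (weight p q)
        = p%:R * weight p.-1 q.+1 - q%:R * weight p.+1 q.-1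
    & cartan (p + q) (weight p q)
        = p%:R * weight p.-1 q.+1 + q%:R * weight p.+1 q.-1].
Proof.
rewrite /lower /cartan deriv_weight /weight natrD.
by case: p => [|p]; case: q => [|q] /=; rewrite ?exprS ?expr0; split; ring.
Qed.

(** This is E^2 - F^2 = (E-F)(E+F) - (EF-FE) with EF - FE = H. *)
Lemma pencil_factor n x f :
  pencil n x f = (f^`() + lower n f)^`() - lower n (f^`() + lower n f)
                 + (x - 1)%:P * cartan n f.
Proof.
rewrite /pencil /lower /cartan !(derivD, derivB, derivM, derivXn, derivX, derivN).
rewrite -!(rmorph_nat (@polyC F)) !derivC /=; ring.
Qed.

(** The pencil is bipartite on the weight vectors: it changes q by one.  The
    predecessors that truncate at 0 come with a zero coefficient. *)
Lemma pencil_weight x p q :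
  pencil (p + q) x (weight p q)
  = (p%:R * (x - 1 + (p%:R - q%:R)))%:P * weight p.-1 q.+1
    + (q%:R * (x - 1 - (p%:R - q%:R)))%:P * weight p.+1 q.-1.
Proof.
have [hE hL hH] := sl2_weight p q.
rewrite pencil_factor hE hH.
have -> : ((p%:R - q%:R) * weight p q)^`()
            - lower (p + q) ((p%:R - q%:R) * weight p q)
          = (p%:R - q%:R) * ((weight p q)^`() - lower (p + q) (weight p q)).
  by rewrite /lower -!(rmorph_nat (@polyC F)) -rmorphB /= derivM derivC; ring.
rewrite hL; ring.
Qed.

(** * Coefficients of the pencil *)

Lemma pencilD n x : {morph pencil n x : f1 f2 / f1 + f2}.
Proof.
move=> f1 f2; rewrite /pencil /lower /cartan !(derivD, derivN, derivM).
by ring.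
Qed.

Lemma pencilZ n x c f : pencil n x (c *: f) = c *: pencil n x f.
Proof.
rewrite /pencil /lower /cartan -!mul_polyC !(derivD, derivN, derivM, derivC).
by ring.
Qed.

Lemma coef_lower n f i :
  (lower n f)`_i = if i is i'.+1 then (n%:R - i'%:R) * f`_i' else 0.
Proof.
rewrite /lower coefB coefXM coefXnM -!(rmorph_nat (@polyC F)) coefCM.
case: i => [|[|i]] /=; rewrite ?subr0 // subn2 /= coef_deriv -mulr_natl.
by ring.
Qed.

Lemma coef_cartan n f i : (cartan n f)`_i = (n%:R - 2 * i%:R) * f`_i.
Proof.
rewrite /cartan -mulrA coefB -!(rmorph_nat (@polyC F)) !coefCM coefXM.
case: i => [|i] /=; first by ring.
by rewrite coef_deriv -mulr_natl; ring.
Qed.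

(** The pencil does not mix parities, and on the even coefficients of f it is
    row i of the tridiagonal matrix, evaluated at x. *)
Lemma coef_pencil_even n x f i : (2 : F) != 0 ->
  (pencil n x f)`_(i.*2) =
    a (i.+1)%:R * f`_(i.+1.*2)
    + (n%:R - 4 * i%:R) * x * f`_(i.*2)
    - (if i is i'.+1 then a ((n%:R - 2 * i%:R + 2) / 2) * f`_(i'.*2) else 0).
Proof.
move=> two_neq0; rewrite /pencil coefD coefB coefCM coef_cartan /a.
have -> k : f^`()^`()`_k = k.+1%:R * (k.+2%:R * f`_k.+2).
  by rewrite !coef_deriv !mulr_natl.
rewrite !doubleS !coef_lower; case: i => [|i] /=.
  by move: f`__ f`__ => u v; rewrite -muln2; ring.
rewrite coef_lower !doubleS.
move: f`_(i.*2) f`_(i.*2.+2) f`_(i.*2.+4) => u v w.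
rewrite -!muln2.
by field; rewrite two_neq0.
Qed.

(** * Kernel vectors *)

(** The recursion that cancels the coefficient of the weight vector with
    q = 2l - 1, to which only the terms l - 1 and l contribute. *)
Fixpoint kernel_coef (n : nat) x (l : nat) : F :=
  if l is l'.+1 then
    - (kernel_coef n x l' * ((n%:R - 2 * l'%:R) * (x - 1 + (n%:R - 4 * l'%:R)))
       / (2 * l%:R * (x - 1 - (n%:R - 4 * l%:R))))
  else 1.

Definition kernel_poly n x s : {poly F} :=
  \sum_(l < s.+1) kernel_coef n x l *: weight (n - l.*2) l.*2.

Lemma size_weight p q : (size (weight p q) <= (p + q).+1)%N.
Proof.
rewrite /weight; apply: leq_trans (size_polyMleq _ _) _.
have size_p : size (1 + 'X : {poly F})%R = 2 by rewrite addrC size_XaddC.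
have size_q : size (1 - 'X : {poly F})%R = 2.
  by rewrite -opprB size_polyN size_XsubC.
have := size_poly_exp_leq (1 + 'X : {poly F}) p.
have := size_poly_exp_leq (1 - 'X : {poly F}) q.
rewrite size_p size_q /= !mul1n.
move: (size _) (size _) => u v; lia.
Qed.

Lemma size_kernel_poly n x s :
  (s.*2 <= n)%N -> (size (kernel_poly n x s) <= n.+1)%N.
Proof.
move=> le_sn; apply: leq_trans (size_sum _ _ _) _; apply/bigmax_leqP => l _.
apply: leq_trans (size_scale_leq _ _) _; apply: leq_trans (size_weight _ _) _.
by rewrite subnK //; have := ltn_ord l; lia.
Qed.

Section Eigen.
Hypothesis charF0 : [pchar F] =i pred0.

Lemma eqr_nat_pchar0 i j : (i%:R == j%:R :> F) = (i == j).
Proof.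
wlog le_ij : i j / (i <= j)%N => [H|].
  by case/orP: (leq_total i j) => /H //; rewrite eq_sym (eq_sym i).
rewrite eq_sym -subr_eq0 -natrB // ((pcharf0P F).1 charF0) subn_eq0.
by rewrite eqn_leq le_ij.
Qed.

Variable m : nat.
Let n := m.*2.+1.
Variable L : nat.
Hypothesis leLm : (L <= m)%N.
Let x : F := 4 * L%:R - n.-1%:R.

(** The recursion makes the images telescope: only the contribution of the last
    term to the next weight vector survives. *)
Lemma pencil_kernel_poly s : (s <= m)%N ->
  pencil n x (kernel_poly n x s)
  = (kernel_coef n x s * ((n%:R - 2 * s%:R) * (x - 1 + (n%:R - 4 * s%:R))))
      *: weight (n - s.*2).-1 s.*2.+1.
Proof.
have E : forall l, (l <= m)%N -> pencil n x (weight (n - l.*2) l.*2) =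
    ((n%:R - 2 * l%:R) * (x - 1 + (n%:R - 4 * l%:R)))
      *: weight (n - l.*2).-1 l.*2.+1
    + (2 * l%:R * (x - 1 - (n%:R - 4 * l%:R)))
      *: weight (n - l.*2).+1 l.*2.-1.
  move=> l lm; have le : (l.*2 <= n)%N by rewrite /n; lia.
  rewrite -{1}(subnK le) pencil_weight !mul_polyC natrB // -muln2 natrM.
  by congr (_ *: _ + _ *: _); ring.
elim: s => [|s IH] sm.
  rewrite /kernel_poly big_ord_recl big_ord0 addr0 pencilZ E //=.
  by rewrite !(mulr0, mul0r) scale0r addr0 scalerA.
rewrite /kernel_poly big_ord_recr /= pencilD -/(kernel_poly n x s) IH; last lia.
rewrite pencilZ E //.
have -> : ((n - s.+1.*2).+1 = (n - s.*2).-1)%N by rewrite /n; lia.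
rewrite doubleS /= scalerDr !scalerA addrCA -scalerDl.
rewrite [X in _ + X *: _](_ : _ = 0) ?scale0r ?addr0 // mulNr.
apply/eqP; rewrite addr_eq0; apply/eqP.
rewrite opprK divfK //; last first.
(* The divisor in the recursion is twice an even minus an odd integer. *)
have -> : x - 1 - (n%:R - 4 * s.+1%:R) = 2 * ((2 * (L + s.+1))%:R - n%:R).
  by rewrite /x /n /= -muln2 !(natrD, natrM) -!natr1 natrM; ring.
rewrite !mulf_eq0 subr_eq0 !((pcharf0P F).1 charF0) eqr_nat_pchar0 /n.
by apply/norP; split=> //; apply/eqP; lia.
Qed.

(** For s = L the second factor is zero, and it divides all the later
    coefficients. *)
Lemma kernel_coef_vanish s : (L <= s)%N ->
  kernel_coef n x s * (x - 1 + (n%:R - 4 * s%:R)) = 0.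
Proof.
elim: s => [|s IH]; rewrite ?leqn0 => hs.
  by rewrite /x (eqP hs) /n /= -natr1; ring.
case: (ltngtP L s.+1) hs => // [lt_Ls|<-] _; last first.
  by rewrite /x /n /= -natr1; ring.
rewrite [kernel_coef _ _ _]/= [X in - (X / _)]mulrCA IH; last lia.
by rewrite mulr0 mul0r oppr0 mul0r.
Qed.

Lemma pencil_kernel_poly_eq0 : pencil n x (kernel_poly n x m) = 0.
Proof.
by rewrite pencil_kernel_poly // mulrCA kernel_coef_vanish // mulr0 scale0r.
Qed.

Lemma kernel_poly_at1 : (kernel_poly n x m).[1] = 2 ^+ n.
Proof.
rewrite /kernel_poly big_ord_recl hornerD horner_sum big1 => [|l _].
  rewrite addr0 scale1r /weight /= expr0 mulr1 horner_exp !hornerE.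
  by rewrite subn0.
have root1 : (1 - 'X : {poly F}).[1] = 0 by rewrite !hornerE subrr.
rewrite hornerZ /weight hornerM !horner_exp root1 expr0n double_eq0.
by rewrite !mulr0.
Qed.

Lemma kernel_poly_at_opp1 : (kernel_poly n x m).[-1] = 0.
Proof.
rewrite /kernel_poly horner_sum big1 // => l _.
have root_opp1 : (1 + 'X : {poly F}).[-1] = 0 by rewrite !hornerE subrr.
rewrite hornerZ /weight hornerM !horner_exp root_opp1 expr0n.
by rewrite (_ : (_ == 0%N) = false) ?mul0r ?mulr0 //; have := ltn_ord l; lia.
Qed.

(** An f without even coefficients would be odd, whereas f(1) + f(-1) = 2^n. *)
Lemma kernel_poly_even_neq0 :
  exists2 i, (i < m.+1)%N & (kernel_poly n x m)`_i.*2 != 0.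
Proof.
case: (boolP [exists i : 'I_m.+1, (kernel_poly n x m)`_(i.*2) != 0]).
  by case/existsP=> i hi; exists i.
rewrite negb_exists => /forallP even0.
suff /eqP : (kernel_poly n x m).[1] + (kernel_poly n x m).[-1] = 0.
  rewrite kernel_poly_at1 kernel_poly_at_opp1 addr0 expf_eq0 /=.
  by rewrite ((pcharf0P F).1 charF0).
have size_f : (size (kernel_poly n x m) <= m.+1.*2)%N.
  exact/size_kernel_poly/leqnSn.
rewrite !(horner_coef_wide _ size_f) -big_split big1 //= => i _.
rewrite expr1n -mulrDr -signr_odd; case odd_i: (odd i) => /=.
  by rewrite subrr mulr0.
have lt_i : (i./2 < m.+1)%N by have := ltn_ord i; lia.
have := even0 (Ordinal lt_i); rewrite negbK /= => /eqP.
by rewrite even_halfK ?odd_i // => ->; rewrite mul0r.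
Qed.
End Eigen.
End Sl2.

(** * The determinant as a characteristic polynomial *)

Lemma natr_odd_sub4_neq0 (F : fieldType) (charF0 : [pchar F] =i pred0) m i :
  (m.*2.+1)%:R - 4 * i%:R != 0 :> F.
Proof.
rewrite -(natrM _ 4) subr_eq0 eqr_nat_pchar0 //; apply/eqP; lia.
Qed.

(** Writing the matrix of P as D (x - A) with D the diagonal matrix of the
    n - 4i, this is the transpose of A: eigenvectors in the sense of
    [eigenvalue] are row vectors, kernel vectors of the pencil are columns. *)
Definition pencil_mx (F : fieldType) (n k : nat) : 'M[F]_k :=
  \matrix_(j, i) ((
    (if i == j.+1 :> nat then a ((n%:R - 2 * j.+1%:R + 2) / 2) else 0)
    - (if j == i.+1 :> nat then a i.+1%:R else 0)) / (n%:R - 4 * i%:R)).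

Lemma P_char_poly (F : fieldType) (charF0 : [pchar F] =i pred0) m k :
  P k ((m.*2.+1)%:R : F)
  = (\prod_(i < k) ((m.*2.+1)%:R - 4 * i%:R)) *: char_poly (pencil_mx F m.*2.+1 k).
Proof.
pose d : 'rV[{poly F}]_k := \row_i ((m.*2.+1)%:R - 4 * i%:R)%:P.
have -> : P k (m.*2.+1)%:R = \det (diag_mx d *m (char_poly_mx (pencil_mx F m.*2.+1 k))^T).
  congr (\det _); rewrite mul_diag_mx; apply/matrixP => i j; rewrite !mxE.
  have di := natr_odd_sub4_neq0 charF0 m i.
  rewrite -(inj_eq val_inj) /=.
  case: eqVneq => [->|neq_ji] /=.
    by rewrite !eqn_leq ltnn andbF subr0 mul0r subr0.
  rewrite mulr0n sub0r -polyCN -polyCM mulrN [_ * (_ / _)]mulrC divfK // opprB.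
  case: (eqVneq (j : nat) i.+1) => [->|_].
    by rewrite (_ : (i == i.+2 :> nat) = false) ?subr0 //; apply/eqP; lia.
  by case: eqP => _; rewrite sub0r ?oppr0.
rewrite det_mulmx det_tr det_diag -mul_polyC rmorph_prod; congr (_ * _).
by apply: eq_bigr => i _; rewrite mxE.
Qed.

Lemma pencil_mx_eigenvalue (F : fieldType) (charF0 : [pchar F] =i pred0) m L :
  (L <= m)%N ->
  eigenvalue (pencil_mx F m.*2.+1 m.+1) (4 * L%:R - (m.*2)%:R).
Proof.
move=> leLm; set x : F := _ - _; pose f := kernel_poly m.*2.+1 x m.
apply/eigenvalueP; exists (\row_(j < m.+1) f`_j.*2); last first.
  have [i lt_im nz_i] := kernel_poly_even_neq0 charF0 leLm.
  apply: contra_neq nz_i => /rowP /(_ (Ordinal lt_im)).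
  by rewrite !mxE.
have two_neq0 : (2 : F) != 0 by rewrite ((pcharf0P F).1 charF0).
apply/rowP => i; rewrite !mxE.
have di := natr_odd_sub4_neq0 charF0 m i.
apply: (mulIf di); rewrite big_distrl /=.
(* Equation i has at most two terms; the guard i = 0 removes the lower one. *)
pose up j := f`_j.*2 * a ((m.*2.+1%:R - 2 * j.+1%:R + 2) / 2).
pose dn j := f`_j.*2 * a (i.+1%:R : F).
transitivity (\sum_(j < m.+1 | j == i.-1 :> nat) (if i == 0 :> nat then 0 else up j)
   - \sum_(j < m.+1 | j == i.+1 :> nat) dn j).
  rewrite [X in _ = X - _]big_mkcond [X in _ = _ - X]big_mkcond -sumrB /=.
  apply: eq_bigr => j _; rewrite !mxE mulrA divfK // mulrBr.
  congr (_ - _); last by case: eqP; rewrite ?mulr0.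
  case: (i : nat) => [|i'] /=; first by rewrite mulr0 if_same.
  by rewrite eqSS eq_sym; case: eqP; rewrite ?mulr0.
rewrite (@big_ord1_eq _ _ _ (fun j => if i == 0 :> nat then 0 else up j)).
rewrite (@big_ord1_eq _ _ _ dn).
have hf := pencil_kernel_poly_eq0 charF0 leLm.
have := coef_pencil_even m.*2.+1 x f i two_neq0; rewrite hf coef0.
(* In the last equation the missing term is a coefficient beyond the degree. *)
have -> : (if (i.+1 < m.+1)%N then dn i.+1 else 0) = f`_i.+1.*2 * a i.+1%:R.
  case: ltnP => // le_mi; rewrite nth_default ?mul0r //.
  apply: leq_trans (size_kernel_poly _ (leqnSn _)) _; lia.
rewrite (leq_ltn_trans (leq_pred _) (ltn_ord i)) /up.
move: (f`_i.+1.*2) => u; case: (i : nat) => [|i'] /= h.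
  by apply/eqP; rewrite -subr_eq0 -oppr_eq0 [X in _ == X]h; apply/eqP; ring.
by apply/eqP; rewrite -subr_eq0 -oppr_eq0 [X in _ == X]h; apply/eqP; ring.
Qed.

Lemma P_factor (F : fieldType) (charF0 : [pchar F] =i pred0) m :
  P m.+1 ((m.*2.+1)%:R : F)
  = (gamma m.*2.+1)%:~R *:
      \prod_(0 <= l < m.+1) ('X - (4 * l%:R - m.*2%:R)%:P).
Proof.
pose rt l : F := 4 * l%:R - m.*2%:R.
rewrite P_char_poly //; congr (_ *: _).
  rewrite /gamma rmorph_prod /= divn2 doubleK big_mkord.
  by apply: eq_bigr => i _; rewrite rmorphB rmorphM /=.
rewrite [LHS](@all_roots_prod_XsubC _ _ [seq rt l | l <- iota 0 m.+1]).
- by rewrite (monicP (char_poly_monic _)) scale1r big_map /index_iota subn0.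
- by rewrite size_char_poly size_map size_iota.
- apply/allP => _ /mapP[l l_lt ->]; rewrite -eigenvalue_root_char.
  by apply: pencil_mx_eigenvalue => //; move: l_lt; rewrite mem_iota; lia.
rewrite uniq_rootsE map_inj_uniq ?iota_uniq // => l1 l2 /addIr /mulfI H.
apply/eqP; rewrite -(eqr_nat_pchar0 charF0) H //.
by rewrite ((pcharf0P F).1 charF0).
Qed.

(** * Pairing opposite roots *)

(** The first and the last factors are conjugate; the middle ones form the same
    kind of product with s.+2 replaced by s. *)
Lemma prod_step4 (R : comNzRingType) (y : R) s :
  \prod_(0 <= l < s.+2) (y - s.+1.*2%:R + (4 * l)%:R)
  = (y ^+ 2 - s.+1.*2%:R ^+ 2) * \prod_(0 <= l < s) (y - s.*2%:R + 2 + (4 * l)%:R).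
Proof.
rewrite big_nat_recl // big_nat_recr //= mulrCA mulrC.
congr (_ * _).
  by rewrite -!muln2; ring.
by apply: eq_bigr => l _; rewrite -!muln2; ring.
Qed.

Lemma prod_symm_odd (R : comNzRingType) (y : R) r :
  \prod_(0 <= l < r.*2.+1) (y - r.*2.*2%:R + (4 * l)%:R)
  = y * \prod_(1 <= l < r.+1) (y ^+ 2 - (4 * l)%:R ^+ 2).
Proof.
elim: r => [|r IH]; first by rewrite big_nat1 big_geq // -!muln2; ring.
rewrite doubleS prod_step4 [in RHS]big_nat_recr //= [RHS]mulrA -IH mulrC.
congr (_ * _); last by rewrite -!muln2; ring.
by apply: eq_bigr => l _; rewrite -!muln2; ring.
Qed.

Lemma prod_symm_even (R : comNzRingType) (y : R) r :
  \prod_(0 <= l < r.*2) (y - r.*2.*2%:R + 2 + (4 * l)%:R)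
  = \prod_(0 <= l < r) (y ^+ 2 - (4 * l + 2)%:R ^+ 2).
Proof.
elim: r => [|r IH]; first by rewrite !big_geq.
rewrite [in RHS]big_nat_recr //= -IH doubleS mulrC.
transitivity (\prod_(0 <= l < r.*2.+2) (y - r.*2.+1.*2%:R + (4 * l)%:R)).
  by apply: eq_bigr => l _; rewrite -!muln2; ring.
by rewrite prod_step4; congr (_ * _); rewrite -!muln2; ring.
Qed.

Theorem theorem7p22 (F : fieldType) (charF0 : [pchar F] =i pred0)
    (n : nat) (n_odd : odd n) :
  [/\ P (n.+1 %/ 2) (n%:R : F)
        = (gamma n)%:~R *: \prod_(0 <= l < (n.-1 %/ 2).+1)
                              ('X - (n.-1)%:R%:P + (4 * l)%:R%:P),
      n = 1 %[mod 4] ->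
      P (n.+1 %/ 2) (n%:R : F)
        = (gamma n)%:~R *: ('X * \prod_(1 <= l < (n.-1 %/ 4).+1)
                              ('X ^+ 2 - ((4 * l)%:R ^+ 2)%:P))
    & n = 3 %[mod 4] ->
      P (n.+1 %/ 2) (n%:R : F)
        = (gamma n)%:~R *: \prod_(0 <= l < ((n - 3) %/ 4).+1)
                              ('X ^+ 2 - ((4 * l + 2)%:R ^+ 2)%:P)].
Proof.
have [m ->] : exists m, n = m.*2.+1 by exists n./2; lia.
have -> : (m.*2.+2 %/ 2 = m.+1)%N by lia.
have -> : (m.*2.+1.-1 %/ 2 = m)%N by lia.
have PE : P m.+1 (m.*2.+1%:R : F) = (gamma m.*2.+1)%:~R *:
    \prod_(0 <= l < m.+1) ('X - m.*2%:R + (4 * l)%:R).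
  rewrite P_factor // big_nat_rev /=; congr (_ *: _).
  apply: eq_big_nat => l /andP[_ lt_lm].
  rewrite add0n subSS natrB // polyCB !polyCM !polyCB /=.
  rewrite !rmorph_nat -!muln2; ring.
split.
- rewrite PE; congr (_ *: _); apply: eq_bigr => l _.
  by rewrite !(rmorph_nat (@polyC F)).
- move=> m_mod; rewrite PE; have [r def_m] : exists r, m = r.*2.
    by exists m./2; lia.
  rewrite def_m (_ : r.*2.*2.+1.-1 %/ 4 = r)%N; last lia.
  rewrite prod_symm_odd; congr (_ *: (_ * _)); apply: eq_bigr => l _.
  by rewrite rmorphXn rmorph_nat.
- move=> m_mod; rewrite PE; have [r def_m] : exists r, m.+1 = r.+1.*2.
    by exists m./2; lia.
rewrite (_ : (m.*2.+1 - 3) %/ 4 = r)%N; last lia.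
rewrite def_m; transitivity ((gamma m.*2.+1)%:~R *: \prod_(0 <= l < r.+1.*2)
    ('X - r.+1.*2.*2%:R + 2 + (4 * l)%:R) : {poly F}).
  congr (_ *: _); apply: eq_bigr => l _.
  by rewrite (_ : m = r.*2.+1) -?muln2; [ring | lia].
rewrite prod_symm_even; congr (_ *: _); apply: eq_bigr => l _.
by rewrite rmorphXn rmorph_nat.
Qed.
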